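(* Let $(M_n(x,q))_{n\ge0}$ be the generalized $q$-Morgan-Voyce polynomials with arbitrary initial values $M_0(x,q)$, $M_1(x,q)$. For every integer $n\ge 2$: (a) $$\sum_{k=0}^{n}(q^{k}-(x+q))M_{k}(x,q)=M_{1}(x,q)-(x+q)M_{0}(x,q)-M_{n+1}(x,q)+q^{n}M_{n}(x,q).$$ (b) $$\sum_{k=1}^{n}(x+1+q)^{n-k}q^{k}M_{k}(x,q)=(x+1+q)^{n}M_{2}(x,q)-M_{n+2}(x,q).$$
   Context: Here $x,q$ are complex numbers with $q\neq 1$. The generalized $q$-Morgan-Voyce polynomials are defined, for arbitrary initial values $M_0(x,q)$, $M_1(x,q)$, by $M_{n}(x,q)=(x+1+q)M_{n-1}(x,q)-q^{n-2}M_{n-2}(x,q)$ for $n\ge 2$. Convention: $0^0=1$. *)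

(* Defs.v *)
From mathcomp Require Import all_boot all_order all_algebra.
From mathcomp Require Import reals complex.

Set Implicit Arguments.
Unset Strict Implicit.
Unset Printing Implicit Defensive.

Import Order.TTheory GRing.Theory Num.Theory.
Local Open Scope ring_scope.

(* The initial values M0 and M1 are arbitrary functions of (x, q). *)
Fixpoint qMorganVoyce (R : realType) (M0 M1 : R[i] -> R[i] -> R[i])
    (n : nat) (x q : R[i]) {struct n} : R[i] :=
  match n with
  | 0%N => M0 x q
  | 1%N => M1 x q
  | (k.+1 as m).+1 =>
      (x + 1 + q) * qMorganVoyce M0 M1 m x q
      - q ^+ k * qMorganVoyce M0 M1 k x q
  end.

(* Main.v *)
Require Import Defs.
From mathcomp Require Import all_boot all_order all_algebra.
From mathcomp Require Import reals complex ring.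

Set Implicit Arguments.
Unset Strict Implicit.
Unset Printing Implicit Defensive.

Import Order.TTheory GRing.Theory Num.Theory.
Local Open Scope ring_scope.

(** With [s = x + 1 + q], both identities are telescoping sums that use only the recurrence
    [M k.+2 = s * M k.+1 - q ^+ k * M k], so they hold over any commutative ring and for any initial
    values. For (a) and k >= 1, the summand is (q^k M_k - q^(k-1) M_(k-1)) - (M_(k+1) - M_k). *)

Lemma sum_qrec_telescope (R : comPzRingType) (s q : R) (M : nat -> R) (n : nat) :
  (forall k, M k.+2 = s * M k.+1 - q ^+ k * M k) ->
  \sum_(0 <= k < n.+1) (q ^+ k - (s - 1)) * M k
    = M 1%N - (s - 1) * M 0%N - M n.+1 + q ^+ n * M n.
Proof.
move=> recM; elim: n => [|n IHn].
  by rewrite big_nat1 expr0; ring.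
by rewrite big_nat_recr //= IHn recM; ring.
Qed.

(** Since q^k M_k = s M_(k+1) - M_(k+2), each summand is s^(n-k+1) M_(k+1) - s^(n-k) M_(k+2), a
    difference of consecutive terms. *)
Lemma sum_qrec_weighted (R : comPzRingType) (s q : R) (M : nat -> R) (n : nat) :
  (forall k, M k.+2 = s * M k.+1 - q ^+ k * M k) ->
  \sum_(1 <= k < n.+1) s ^+ (n - k) * q ^+ k * M k
    = s ^+ n * M 2%N - M n.+2.
Proof.
move=> recM; elim: n => [|n IHn].
  by rewrite big_geq // expr0 mul1r subrr.
(* The weights depend on [n], so passing to [n.+1] also multiplies the old sum by [s]. *)
have -> : \sum_(1 <= k < n.+2) s ^+ (n.+1 - k) * q ^+ k * M k
    = s * (\sum_(1 <= k < n.+1) s ^+ (n - k) * q ^+ k * M k)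
      + q ^+ n.+1 * M n.+1.
  rewrite big_nat_recr //= subnn expr0 mul1r mulr_sumr; congr (_ + _).
  apply: eq_big_nat => k /andP[_ lekn].
  (* The truncated subtraction is harmless because k <= n. *)
  by rewrite subSn // exprS !mulrA.
by rewrite IHn (recM n.+1) (exprS s) mulrBr mulrA opprB addrA addrAC.
Qed.

Theorem theorem21 (R : realType) (M0 M1 : R[i] -> R[i] -> R[i]) (x q : R[i])
    (hq : q <> 1) (n : nat) (hn : (2 <= n)%N) :
  let M := qMorganVoyce M0 M1 in
  (\sum_(0 <= k < n.+1) (q ^+ k - (x + q)) * M k x q
     = M 1%N x q - (x + q) * M 0%N x q - M n.+1 x q + q ^+ n * M n x q)
  /\
  (\sum_(1 <= k < n.+1) (x + 1 + q) ^+ (n - k) * q ^+ k * M k x q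
     = (x + 1 + q) ^+ n * M 2%N x q - M n.+2 x q).
Proof.
move=> M.
have recM k : M k.+2 x q = (x + 1 + q) * M k.+1 x q - q ^+ k * M k x q by [].
split; last exact: (sum_qrec_weighted (M := fun k => M k x q)).
(* This exposes the coefficient as [s - 1]. *)
have -> : x + q = x + 1 + q - 1 by ring.
exact: (sum_qrec_telescope (M := fun k => M k x q)).
Qed.
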